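(* Let $\tau\in S_d$, let $r_1=1$, and let $R\in\mathbb N_+$ satisfy $\min\{n_{\tau(1)},n_{\tau(d)}\}\ge R$ and $\min_{2\le j\le d-1} n_{\tau(j)}\ge R^2>\max_{2\le j\le d} r_j\ge\min_{2\le j\le d} r_j\ge R$. Then for any three distinct indices $i_1,i_2,i_3\in\{1,\dots,d\}$ there is a Lebesgue-measure-zero set $\mathcal N\subset\mathcal U^d_{\vec r,\vec n,\tau}$ such that for every $\vec{\mathbf u}\in\mathcal U^d_{\vec r,\vec n,\tau}\setminus\mathcal N$, the output of the Three-Index Algorithm, run with the integer $R$ on $i_1,i_2,i_3$ and with exact access to the entries of $\mathbf T=\varphi(\vec{\mathbf u},\tau)$, is of the correct order with respect to $\tau$.
   Context: **Tensor train format.** $d$ is a positive integer, $S_d$ is the group of permutations of $\{1,\dots,d\}$, and $\vec n=(n_1,\dots,n_d)$, $\vec r=(r_1,\dots,r_d)$ are vectors of positive integers with $r_1=1$; subscripts of $r$ are read modulo $d$ (so $r_{d+1}=r_1=1$). For $\tau\in S_d$ let $\mathcal U^d_{\vec r,\vec n,\tau}=\bigoplus_{i=1}^d\mathbb R^{r_{\tau^{-1}(i)}\times n_i\times r_{\tau^{-1}(i)+1}}$, a Euclidean space with Lebesgue measure. For $\vec{\mathbf u}=(\mathbf u^{[1]},\dots,\mathbf u^{[d]})$ in it, write $\mathbf u^{[i]}(x)=\mathbf u^{[i]}(:,x,:)\in\mathbb R^{r_{\tau^{-1}(i)}\times r_{\tau^{-1}(i)+1}}$. The tensor $\varphi(\vec{\mathbf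 u},\tau)\in\mathbb R^{n_1\times\cdots\times n_d}$ has entries (the $1\times1$ matrix product) $$\varphi(\vec{\mathbf u},\tau)(x_1,\dots,x_d)=\mathbf u^{[\tau(1)]}(x_{\tau(1)})\,\mathbf u^{[\tau(2)]}(x_{\tau(2)})\cdots\mathbf u^{[\tau(d)]}(x_{\tau(d)}).$$ **Correct order.** For distinct $i_1,i_2,i_3\in\{1,\dots,d\}$, $(i_1,i_2,i_3)$ is of the correct order with respect to $\tau$ if $\tau^{-1}(i_1)<\tau^{-1}(i_2)<\tau^{-1}(i_3)$ or $\tau^{-1}(i_3)<\tau^{-1}(i_2)<\tau^{-1}(i_1)$. **Matricizations.** Given distinct $i_1,i_2,i_3$ and fixed $y_i\in\{1,\dots,n_i\}$ for $i\notin\{i_1,i_2,i_3\}$, let $A(x_{i_1},x_{i_2},x_{i_3})$ be the entry of the tensor whose $i_s$-th coordinate is $x_{i_s}$ ($1\le s\le3$) and whose $i$-th coordinate is $y_i$ for all other $i$. Define $M_{i_1,(i_2,i_3)}\in\mathbb R^{n_{i_1}\times(n_{i_2}n_{i_3})}$, $M_{i_2,(i_3,i_1)}\in\mathbb R^{n_{i_2}\times(n_{i_3}n_{i_1})}$, $M_{i_3,(i_1,i_2)}\in\mathbb R^{n_{i_3}\times(n_{i_1}n_{i_2})}$ by $M_{i_1,(i_2,i_3)}(x_{i_1},(x_{i_2},x_{i_3}))=M_{i_2,(i_3,i_1)}(x_{i_2},(x_{i_3},x_{i_1}))=M_{i_3,(i_1,i_2)}(x_{i_3},(x_{i_1},x_{i_2}))=A(x_{i_1},x_{i_2},x_{i_3})$.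 $\sigma_k(M)$ denotes the $k$-th largest singular value of $M$, with $\sigma_k(M)=0$ if $k$ exceeds the smaller dimension of $M$. **Three-Index Algorithm.** Input: $i_1,i_2,i_3$, an integer $R\in\mathbb N_+$, and an oracle for the entries of $\mathbf T$. Sample (i.e. pick arbitrarily) $y_i\in\{1,\dots,n_i\}$ for $i\notin\{i_1,i_2,i_3\}$; form the three matrices above from $\mathbf T$. Compare $a=\sigma_{R^2}(M_{i_1,(i_2,i_3)})$, $b=\sigma_{R^2}(M_{i_2,(i_3,i_1)})$, $c=\sigma_{R^2}(M_{i_3,(i_1,i_2)})$. If $a>\max\{b,c\}$ return $(i_2,i_1,i_3)$; if $b>\max\{a,c\}$ return $(i_1,i_2,i_3)$; if $c>\max\{a,b\}$ return $(i_2,i_3,i_1)$. *)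

(* Defs.v *)
From HB Require Import structures.
From mathcomp Require Import all_boot all_order all_algebra all_fingroup.
From mathcomp Require Import polyrcf.
From mathcomp Require Import classical_sets reals ereal topology normedtype.
From mathcomp Require Import sequences.

Set Implicit Arguments.
Unset Strict Implicit.
Unset Printing Implicit Defensive.

Import Order.TTheory GRing.Theory Num.Theory.
Local Open Scope ring_scope.

Section Lebesgue.
Variables (R : realType) (I : finType).
Local Open Scope classical_set_scope.
Local Open Scope ereal_scope.

Definition box (a b : I -> R) : set (I -> R) :=
  [set v | forall i, (a i <= v i <= b i)%R].

Definition box_cover (A : set (I -> R)) : set (nat -> (I -> R) * (I -> R)) :=
  [set ab | (forall k i, ((ab k).1 i <= (ab k).2 i)%R) /\
            A `<=` \bigcup_k box (ab k).1 (ab k).2].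

(* Zero outer measure is the same as being Lebesgue measurable of measure 0. *)
Definition lebesgue_outer (A : set (I -> R)) : \bar R :=
  ereal_inf [set \sum_(0 <= k <oo) (\prod_i ((ab k).2 i - (ab k).1 i))%R%:E
            | ab in box_cover A].

End Lebesgue.

Section SingularValues.
Variables (R : realType) (m n : nat).

(* The eigenvalues of M M^T are the real roots of its characteristic
   polynomial, all of which are real and nonnegative; mup restores the
   multiplicities, which rootsR forgets. *)
Definition gram_eigenvalues (M : 'M[R]_(m, n)) : seq R :=
  let p := char_poly (M *m M^T) in
  flatten [seq nseq (mup x p) x | x <- rootsR p].

(* k is counted from 1. *)
Definition sigma (k : nat) (M : 'M[R]_(m, n)) : R :=
  if (0 < k <= minn m n)%N
  then (sort >=%R [seq Num.sqrt x | x <- gram_eigenvalues M])`_k.-1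
  else 0.

End SingularValues.

(* Modes and positions are numbered 0, ..., d, so the order of the tensor is
   d.+1; r j is the dimension of the bond to the left of position j. *)
Section TensorTrain.
Variables (R : realType) (d : nat).
Variables (n r : 'I_d.+1 -> nat).

(* Subscripts of r are read modulo d.+1. *)
Definition bond (k : nat) : nat := r (inZp k).

Definition multi_index : Type := forall i : 'I_d.+1, 'I_(n i).

Definition tensor : Type := multi_index -> R.

Definition core_space (tau : 'S_d.+1) : Type :=
  forall i : 'I_d.+1,
    'I_(n i) -> 'M[R]_(bond ((tau^-1)%g i), bond ((tau^-1)%g i).+1).

Definition coord (tau : 'S_d.+1) : finType :=
  {i : 'I_d.+1 &
    ('I_(n i) * ('I_(bond ((tau^-1)%g i)) * 'I_(bond ((tau^-1)%g i).+1)))%type}.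

Definition coords (tau : 'S_d.+1) (u : core_space tau) : coord tau -> R :=
  fun c => u (tag c) (tagged c).1 (tagged c).2.1 (tagged c).2.2.

Definition lebesgue_null (tau : 'S_d.+1) (N : set (core_space tau)) : Prop :=
  lebesgue_outer [set coords u | u in N]%classic = 0%E.

Lemma core_dims (tau : 'S_d.+1) (k : nat) :
  (bond ((tau^-1)%g (tau (inZp k))) = bond k) *
  (bond ((tau^-1)%g (tau (inZp k))).+1 = bond k.+1).
Proof.
rewrite permK /bond; split; congr r; apply: val_inj => /=.
  exact: modn_mod.
by rewrite -addn1 modnDml addn1.
Qed.

Definition factor (tau : 'S_d.+1) (u : core_space tau) (x : multi_index)
    (k : nat) : 'M[R]_(bond k, bond k.+1) :=
  castmx (core_dims tau k) (u (tau (inZp k)) (x (tau (inZp k)))).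

Fixpoint factor_prod (tau : 'S_d.+1) (u : core_space tau) (x : multi_index)
    (k : nat) : 'M[R]_(bond 0, bond k) :=
  if k is k'.+1 then factor_prod u x k' *m factor u x k' else 1%:M.

Lemma bond_ends : r ord0 = 1%N -> (bond 0 = 1%N) * (bond d.+1 = 1%N).
Proof.
move=> <-; rewrite /bond.
by split; congr r; apply: val_inj; rewrite /= ?modnn ?mod0n.
Qed.

Definition phi (r1 : r ord0 = 1%N) (tau : 'S_d.+1) (u : core_space tau) :
    tensor :=
  fun x => castmx (bond_ends r1) (factor_prod u x d.+1) ord0 ord0.

Definition correct_order (tau : 'S_d.+1) (i : 'I_d.+1 * 'I_d.+1 * 'I_d.+1) :
    bool :=
  let: (i1, i2, i3) := i in
  let p := (tau^-1)%g in
  (p i1 < p i2 < p i3)%N || (p i3 < p i2 < p i1)%N.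

(* The values of y at i1, i2, i3 are overwritten. *)
Definition slice (T : tensor) (y : multi_index) (i1 i2 i3 : 'I_d.+1)
    (x1 : 'I_(n i1)) (x2 : 'I_(n i2)) (x3 : 'I_(n i3)) : R :=
  T (dfwith (dfwith (dfwith y x1) x2) x3).

(* The column indexed by the pair (b, c) is the column mxvec_index b c. *)
Definition matricize (m1 m2 m3 : nat) (A : 'I_m1 -> 'I_m2 -> 'I_m3 -> R) :
    'M[R]_(m1, m2 * m3) :=
  \matrix_(a < m1) mxvec (\matrix_(b < m2, c < m3) A a b c).

(* None: the largest of the three singular values is attained twice, and the
   algorithm returns nothing. *)
Definition three_index (rho : nat) (i1 i2 i3 : 'I_d.+1) (T : tensor)
    (y : multi_index) : option ('I_d.+1 * 'I_d.+1 * 'I_d.+1) :=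
  let A := slice T y (i1 := i1) (i2 := i2) (i3 := i3) in
  let a := sigma (rho ^ 2) (matricize (fun x1 x2 x3 => A x1 x2 x3)) in
  let b := sigma (rho ^ 2) (matricize (fun x2 x3 x1 => A x1 x2 x3)) in
  let c := sigma (rho ^ 2) (matricize (fun x3 x1 x2 => A x1 x2 x3)) in
  if a > Num.max b c then Some (i2, i1, i3)
  else if b > Num.max a c then Some (i1, i2, i3)
  else if c > Num.max a b then Some (i2, i3, i1)
  else None.

End TensorTrain.

(* Main.v *)
Require Import Defs.
From HB Require Import structures.
From mathcomp Require Import all_boot all_order all_algebra all_fingroup.
From mathcomp Require Import complex spectral polyrcf zify lra ring.
From mathcomp Require Import boolp classical_sets reals ereal.
From mathcomp Require Import normedtype sequences.

(** Fix three modes and freeze the other coordinates.  Up to transposition, the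
    matricization whose rows are indexed by a mode lying outside the other two
    in the train is cut by a single bond: every entry of the slice is a sum,
    over the values of that bond, of a term seeing only the row mode times a
    term seeing only the two column modes.  Its rank is therefore at most the
    bond dimension, which is less than rho ^ 2, and sigma_(rho ^ 2) vanishes
    for every choice of the cores ([sigma_slice_outer]).

    The matricization whose rows are indexed by the middle mode is separated
    from the columns by two bonds, of dimension at least rho each, and the modes
    are large enough, so nothing prevents rank rho ^ 2.  Having rank at least
    rho ^ 2 follows from the nonvanishing of one fixed minor, a polynomial in
    the entries of the cores.

    This polynomial is not zero: cores made of zeros and ones, which match the
    first coordinate with the left bond, the third with the right bond, and the
    pair of bond values with the base rho digits of the middle coordinate, turn
    the minor into the determinant of the identity matrix ([phi_delta_cores]).
    These cores ignore the frozen coordinates, so the product of the minors over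
    all frozen multi-indices is still a nonzero polynomial, and off its zero set
    sigma_(rho ^ 2) is positive for all of them at once ([sigma_slice_middle]).
    The algorithm then sees one positive number and two zeros, and puts the
    right mode in the middle.

    Two classical facts support this.  First, sigma_k M > 0 exactly when
    k <= rank M ([sigma_gt0]): the Gram matrix of M is real symmetric, hence
    unitarily diagonalizable over the complex numbers with real eigenvalues, so
    its characteristic polynomial splits over the reals, and the number of
    nonzero roots is its rank, which is the rank of M.

    Second, the zero set of a nonzero polynomial function f has measure zero
    ([polyfun_zeros_null]).  The covers are explicit.  Cut the cube of
    half-side M, in N variables, into m ^ N small cubes.  Since f is Lipschitz
    on the big cube, a small cube meeting the zero set has a corner at which f
    is small, so it is enough that the proportion of grid points at which f is
    small can be made arbitrarily small ([polyfun_grid_sublevel]).  This is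
    proved by releasing the coordinates one at a time, starting from a point u
    with f u != 0: if f is not small once the i-th coordinate is reset to that
    of u, then on the line obtained by moving this coordinate f is a univariate
    polynomial of bounded degree that is not small somewhere, and such a
    polynomial is small at few grid points ([grid_sublevel_card]). *)

Set Implicit Arguments.
Unset Strict Implicit.
Unset Printing Implicit Defensive.

Import Order.TTheory GRing.Theory Num.Theory.
Local Open Scope ring_scope.

(** * Singular values and rank *)

Lemma char_poly_conj (F : fieldType) m (P A : 'M[F]_m) : P \in unitmx ->
  char_poly (invmx P *m A *m P) = char_poly A.
Proof.
move=> P_unit; have Pp_unit : map_mx polyC P \in unitmx by rewrite map_unitmx.
rewrite /char_poly /char_poly_mx !map_mxM map_invmx.
set Q := map_mx polyC P in Pp_unit *.
have -> : 'X%:M - invmx Q *m map_mx polyC A *m Q =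
          invmx Q *m ('X%:M - map_mx polyC A) *m Q.
  by rewrite mulmxBr mulmxBl scalar_mxC mulmxKV.
rewrite !det_mulmx det_inv mulrAC mulVr ?mul1r // -unitmxE //.
Qed.

Lemma rank_diag_mx (F : fieldType) m (d : 'rV[F]_m) :
  \rank (diag_mx d) = (\sum_(i < m) (d 0%R i != 0%R))%N.
Proof.
elim: m d => [|m IHm] d; first by rewrite [diag_mx d]flatmx0 mxrank0 big_ord0.
rewrite -[m.+1]/(1 + m)%N in d *.
rewrite -{1}(hsubmxK d) diag_mx_row rank_diag_block_mx IHm.
rewrite big_split_ord big_ord1 /=.
congr addn; last by apply: eq_bigr => i _; rewrite mxE.
have -> : diag_mx (lsubmx d) = (d 0 (lshift m 0))%:M.
  by apply/matrixP=> i j; rewrite !ord1 !mxE.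
rewrite rank_rV; congr (nat_of_bool (~~ _)).
apply/eqP/eqP => [/matrixP/(_ 0 0)|->].
  by rewrite !mxE eqxx.
by apply/matrixP=> i j; rewrite !mxE mul0rn.
Qed.

Section SingularValues.
Variable R : realType.

(** The spectral theorem, applied to [A] seen as a Hermitian matrix over the
    complex numbers; the eigenvalues found there are real, so the factorization
    of the characteristic polynomial descends to the reals. *)
Lemma symmetric_char_poly m (A : 'M[R]_m) : A^T = A ->
  exists2 d : 'rV[R]_m, char_poly A = \prod_(i < m) ('X - (d 0 i)%:P) &
    \rank A = (\sum_(i < m) (d 0%R i != 0%R))%N.
Proof.
move=> A_sym; pose toC := real_complex R; pose B := map_mx toC A.
have B_real : B \is a mxOver Num.real.
  by apply/mxOverP => i j; rewrite mxE complex_real.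
have B_sym : B \is symmetricmx.
  apply/is_hermitianmxP; rewrite expr0 scale1r map_mx_id //.
  by rewrite /B map_trmx A_sym.
have B_herm := realsym_hermsym B_sym B_real.
have /orthomx_spectralP B_eq := symmetric_normalmx B_sym B_real.
have /mxOverP D_real := hermitian_spectral_diag_real B_herm.
set P := spectralmx B in B_eq; set D := spectral_diag B in B_eq D_real.
have P_unit : P \in unitmx := spectral_unit B.
pose d : 'rV[R]_m := \row_i complex.Re (D 0 i).
have toC_d i : toC (d 0 i) = D 0 i by rewrite mxE [LHS]RRe_real.
exists d.
  apply: (map_poly_inj toC); rewrite map_char_poly -/B B_eq char_poly_conj //.
  rewrite char_poly_trig ?diag_mx_is_trig // rmorph_prod.
  apply: eq_bigr => i _ /=.
  rewrite rmorphB /= map_polyX map_polyC /= [diag_mx _ _ _]mxE eqxx mulr1n.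
  by rewrite -toC_d.
rewrite -(mxrank_map toC) -/B B_eq mxrankMfree ?row_free_unit //.
rewrite -mxrank_tr trmx_mul mxrankMfree;
  last by rewrite row_free_unit unitmx_tr unitmx_inv.
rewrite mxrank_tr rank_diag_mx; apply: eq_bigr => i _.
by rewrite -toC_d fmorph_eq0.
Qed.

Lemma mulmx_tr_ge0 n (v : 'rV[R]_n) : 0 <= (v *m v^T) 0 0.
Proof. by rewrite mxE sumr_ge0 // => i _; rewrite mxE -expr2 sqr_ge0. Qed.

Lemma mulmx_tr_eq0 n (v : 'rV[R]_n) : (v *m v^T) 0 0 = 0 -> v = 0.
Proof.
rewrite mxE => /eqP; rewrite psumr_eq0 => [/allP v0|i _]; last first.
  by rewrite mxE -expr2 sqr_ge0.
apply/rowP=> i; have := v0 i (mem_index_enum i).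
by rewrite !mxE mulf_eq0 orbb => /eqP.
Qed.

(** Both matrices have the same left kernel, because a vector [v] with
    [v *m M *m M^T = 0] satisfies [|v *m M|^2 = 0]. *)
Lemma gram_rank m n (M : 'M[R]_(m, n)) : \rank (M *m M^T) = \rank M.
Proof.
apply/eqP; rewrite eqn_leq mxrankM_maxl /=.
have : (\rank (kermx (M *m M^T)) <= \rank (kermx M))%N; last first.
  rewrite !mxrank_ker; have := rank_leq_row M; have := rank_leq_row (M *m M^T).
  move: (\rank _) (\rank M) => a b; lia.
apply/mxrankS/row_subP => i.
set v := row i _; have v_ker : v *m (M *m M^T) = 0.
  by apply/sub_kermxP; rewrite row_sub.
apply/sub_kermxP; apply: mulmx_tr_eq0.
by rewrite trmx_mul mulmxA -[_ *m M^T]mulmxA v_ker mul0mx mxE.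
Qed.

Lemma gram_eigenvalue_ge0 m n (M : 'M[R]_(m, n)) (x : R) :
  root (char_poly (M *m M^T)) x -> 0 <= x.
Proof.
rewrite -eigenvalue_root_char => /eigenvalueP[v v_eig v_neq0].
have vv_gt0 : 0 < (v *m v^T) 0 0.
  rewrite lt0r mulmx_tr_ge0 andbT.
  by apply: contra_neq v_neq0; apply: mulmx_tr_eq0.
rewrite -(pmulr_lge0 _ vv_gt0).
have -> : x * (v *m v^T) 0 0 = (v *m M *m (v *m M)^T) 0 0.
  by rewrite trmx_mul mulmxA -[v *m M *m M^T]mulmxA v_eig -scalemxAl [RHS]mxE.
exact: mulmx_tr_ge0.
Qed.

(** The listed roots, repeated by multiplicity, are all the diagonal entries of
    a diagonalization of the Gram matrix; the zero ones account for the rank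
    defect and the others are positive. *)
Lemma count_gram_eigenvalues m n (M : 'M[R]_(m, n)) :
  count (fun x => 0 < x) (gram_eigenvalues M) = \rank M.
Proof.
have sym : (M *m M^T)^T = M *m M^T by rewrite trmx_mul trmxK.
have [d char_d rank_d] := symmetric_char_poly sym.
have p_neq0 : char_poly (M *m M^T) != 0 by rewrite monic_neq0 ?char_poly_monic.
have /seq.permP -> : perm_eq (gram_eigenvalues M) [seq d 0 i | i <- enum 'I_m].
  apply/allP=> y _ /=; apply/eqP.
  have -> : count_mem y [seq d 0 i | i <- enum 'I_m] =
            mup y (char_poly (M *m M^T)).
    by rewrite -mu_prod_XsubC char_d big_map big_enum.
  rewrite /gram_eigenvalues; set p := char_poly _ in p_neq0 *.
  rewrite count_flatten -map_comp sumnE big_map.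
  have [y_root|y_nroot] := boolP (root p y).
    have y_in : y \in rootsR p by rewrite -(roots_on_rootsR p_neq0) y_root.
    rewrite (bigD1_seq y) //=; last exact: uniq_roots.
    rewrite big1 ?addn0 => [|x x_neq]; last first.
      by rewrite count_nseq /= (negbTE x_neq).
    by rewrite count_nseq /= eqxx mul1n.
  rewrite (mupNroot y_nroot) big1_seq // => x /andP[_ x_in] /=.
  rewrite count_nseq /=; case: eqP => // eq_xy; move: x_in.
  by rewrite eq_xy -(roots_on_rootsR p_neq0) (negbTE y_nroot) andbF.
rewrite -gram_rank rank_d count_map -sum1_count big_enum_cond /= big_mkcond /=.
apply: eq_bigr => i _; have : 0 <= d 0 i.
  apply: (@gram_eigenvalue_ge0 m n M); rewrite char_d.
  by rewrite rootE horner_prod (bigD1 i) //= hornerXsubC subrr mul0r.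
by rewrite le0r => /predU1P[->|d_gt0]; rewrite ?ltxx ?eqxx ?d_gt0 ?gt_eqF.
Qed.

(** The positive entries of a nonincreasing list are its first ones; past the
    end, the default value 0 of [nth] agrees with the claim. *)
Lemma nth_sorted_gt0 (s : seq R) j : sorted >=%R s -> all (fun x => 0 <= x) s ->
  (0 < s`_j) = (j < count (fun x => 0%R < x)%R s)%N.
Proof.
elim: s j => [|x s IHs] j /=; first by rewrite nth_nil ltxx.
move=> s_path /andP[x_ge0 s_ge0]; have s_sorted := path_sorted s_path.
have [x_gt0|x_le0] := ltP 0 x.
  by case: j => [|j] /=; rewrite ?x_gt0 // IHs.
have s_le0 : all (fun y => y <= 0) s.
  have /allP s_le := order_path_min (fun y x z xy yz => le_trans yz xy) s_path.
  by apply/allP => y /s_le /le_trans; apply.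
have /eqP -> : count (fun y => 0 < y) s == 0%N.
  rewrite -leqn0 leqNgt -has_count; apply/hasPn => y y_s.
  by rewrite -leNgt (allP s_le0).
rewrite addn0 ltn0; apply/negbTE; rewrite -leNgt.
case: j => //= j.
have [lt_j|ge_j] := ltnP j (size s); last by rewrite nth_default.
by apply: (allP s_le0); rewrite mem_nth.
Qed.

Lemma sigma_gt0 m n k (M : 'M[R]_(m, n)) : (0 < k)%N ->
  (0 < sigma k M) = (k <= \rank M)%N.
Proof.
move=> k_gt0; rewrite /sigma k_gt0 /=.
have [le_k|gt_k] := leqP k (minn m n); last first.
  rewrite ltxx; apply/esym/negbTE; rewrite -ltnNge; apply: leq_ltn_trans gt_k.
  by rewrite leq_min rank_leq_row rank_leq_col.
rewrite nth_sorted_gt0; first last.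
- by rewrite all_sort; apply/allP => _ /mapP[x _ ->]; rewrite sqrtr_ge0.
- by apply: sort_sorted => x y; apply: le_total.
rewrite count_sort count_map (eq_count (a2 := fun x => 0 < x)) => [|x].
  by rewrite count_gram_eigenvalues prednK.
by rewrite /= sqrtr_gt0.
Qed.

Lemma sigma_ge0 m n k (M : 'M[R]_(m, n)) : 0 <= sigma k M.
Proof.
rewrite /sigma; case: ifP => // _; set s := sort _ _.
have s_ge0 : all (fun x => 0 <= x) s.
  by rewrite all_sort; apply/allP => _ /mapP[x _ ->]; rewrite sqrtr_ge0.
have [lt_k|ge_k] := ltnP k.-1 (size s); last by rewrite nth_default.
by apply: (allP s_ge0); rewrite mem_nth.
Qed.

Lemma sigma_eq0 m n k (M : 'M[R]_(m, n)) : (\rank M < k)%N -> sigma k M = 0.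
Proof.
move=> lt_k; apply/eqP; rewrite eq_le sigma_ge0 andbT leNgt sigma_gt0.
  by rewrite -ltnNge.
exact: leq_ltn_trans lt_k.
Qed.

End SingularValues.

(** * Null sets from finite box covers *)

Section NullSets.
Variables (R : realType) (I : finType).
Local Notation boxes := ((I -> R) * (I -> R))%type.

Definition vol (c : boxes) : R := \prod_i (c.2 i - c.1 i).

Lemma vol_ge0 (c : boxes) : (forall i, c.1 i <= c.2 i) -> 0 <= vol c.
Proof. by move=> c_le; apply: prodr_ge0 => i _; rewrite subr_ge0. Qed.

Lemma lebesgue_outer_eq0 (A : set (I -> R)) :
  (forall e : R, 0 < e -> exists ab : nat -> boxes,
     [/\ forall k i, (ab k).1 i <= (ab k).2 i,
         forall v, A v -> exists k, box (ab k).1 (ab k).2 v &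
         forall m, \sum_(k < m) vol (ab k) <= e]) ->
  lebesgue_outer A = 0%E.
Proof.
move=> cover; apply/eqP; rewrite eq_le; apply/andP; split; last first.
  apply: le_ereal_inf_tmp => _ [ab [ab_le _] <-].
  apply: nneseries_ge0 => k _ _; rewrite lee_fin.
  exact: (@vol_ge0 (ab k) (ab_le k)).
apply/lee_addgt0Pr => e e_gt0; rewrite add0e.
have [ab [ab_le A_ab sum_ab]] := cover e e_gt0.
apply: ge_ereal_inf.
exists (\sum_(0 <= k <oo) (vol (ab k))%:E)%E.
  exists ab => //; split=> // v /A_ab[k]; by exists k.
apply: lime_le.
  by apply: is_cvg_nneseries => k _ _; rewrite lee_fin vol_ge0.
by near=> m; rewrite sumEFin lee_fin big_mkord.
Unshelve. all: by end_near. Qed.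

Definition point_box : boxes := (fun=> 0, fun=> 0).

Lemma vol_point_box (i0 : I) : vol point_box = 0.
Proof. by rewrite /vol (bigD1 i0) //= subrr mul0r. Qed.

Definition proper_boxes (s : seq boxes) : Prop :=
  forall k i, (nth point_box s k).1 i <= (nth point_box s k).2 i.

(** Countable subadditivity at measure 0, for sets that have finite covers of
    arbitrarily small volume.  The finite covers of the sets, the [M]-th one of
    volume at most [e / 2 ^ (M + 1)], are concatenated; an index [i0] is
    required because every box has volume 1 in dimension 0. *)
Lemma lebesgue_outer_bigcup_eq0 (i0 : I) (A : nat -> set (I -> R)) :
  (forall M (e : R), 0 < e -> exists s : seq boxes,
     [/\ proper_boxes s,
         forall v, A M v -> exists2 k, (k < size s)%N &
           box (nth point_box s k).1 (nth point_box s k).2 v &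
         \sum_(c <- s) vol c <= e]) ->
  lebesgue_outer (\bigcup_M A M)%classic = 0%E.
Proof.
move=> cover; apply: lebesgue_outer_eq0 => e e_gt0.
have e2_gt0 M : 0 < e / 2 ^+ M.+1 by rewrite divr_gt0 ?exprn_gt0.
have [s s_cover] := choice (fun M => cover M _ (e2_gt0 M)).
(* Prefixing each block with a degenerate box makes the length of the
   concatenation of [m] blocks at least [m], so that the [k]-th box can be read
   off the first [k + 1] blocks. *)
pose F m := flatten [seq point_box :: s M | M <- iota 0 m].
have FS m : F m.+1 = F m ++ point_box :: s m.
  by rewrite /F -addn1 iotaD map_cat flatten_cat /= cats0.
have size_F m : (m <= size (F m))%N.
  elim: m => // m IHm; rewrite FS size_cat /= addnS ltnS.
  exact: leq_trans IHm (leq_addr _ _).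
have nth_F m m' k : (m <= m')%N -> (k < size (F m))%N ->
    nth point_box (F m') k = nth point_box (F m) k.
  move=> + k_lt; elim: m' => [|m' IHm']; first by rewrite leqn0 => /eqP->.
  rewrite leq_eqVlt => /predU1P[->//|lt_mm'].
  rewrite FS nth_cat (leq_trans k_lt) ?IHm' //.
  have /subnK <- := (lt_mm' : (m <= m')%N); elim: (m' - m)%N => // p IHp.
  by rewrite addSn FS size_cat (leq_trans IHp) ?leq_addr.
have proper_F m : proper_boxes (F m).
  elim: m => [|m IHm] k i; first by rewrite nth_nil.
  rewrite FS nth_cat; case: ifP => // _.
  case: (k - _)%N => //= k'; have [p _ _] := s_cover m; exact: p.
have sum_F m : \sum_(c <- F m) vol c <= e * (1 - 2^-1 ^+ m).
  elim: m => [|m IHm]; first by rewrite big_nil expr0 subrr mulr0.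
  rewrite FS big_cat big_cons /= vol_point_box // add0r.
  have [_ _ le_s] := s_cover m.
  rewrite (le_trans (lerD IHm le_s)) // -mulrDr ler_wpM2l ?(ltW e_gt0) //.
  rewrite !exprVn exprSr invfM.
  set x := (_ ^+ m)^-1; lra.
exists (fun k => nth point_box (F k.+1) k); split=> [k i|v [M _]|m].
- exact: proper_F.
- move=> AMv; have [_ /(_ v AMv)[k k_lt v_k] _] := s_cover M.
  exists (size (F M) + k.+1)%N.
  have le1 : (size (F M) + k.+1 < size (F M.+1))%N.
    by rewrite FS size_cat /= ltn_add2l ltnS.
  set K := (size (F M) + k.+1)%N in le1 *.
  rewrite -(nth_F K.+1 (maxn M.+1 K.+1)) ?leq_maxr ?size_F //.
  by rewrite (nth_F M.+1) ?leq_maxl // FS nth_cat /K ltnNge leq_addr addKn /=.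
- have -> : \sum_(k < m) vol (nth point_box (F k.+1) k) =
            \sum_(c <- take m (F m)) vol c.
    rewrite (big_nth point_box) size_take_min (minn_idPl _) ?size_F //.
    rewrite big_mkord.
    apply: eq_bigr => k _; rewrite nth_take //.
    by rewrite (nth_F k.+1 m) ?size_F.
  apply: (@le_trans _ _ (\sum_(c <- F m) vol c)).
    rewrite -{2}(cat_take_drop m (F m)) big_cat /= lerDl.
    rewrite (big_nth point_box) big_mkord sumr_ge0 // => k _.
    by apply: vol_ge0 => i; rewrite nth_drop; apply: proper_F.
  rewrite (le_trans (sum_F m)) // ger_pMr // gerBl exprn_ge0 //.
Qed.

End NullSets.

(** * Sublevel sets of univariate polynomials on a grid *)

Section UnivariateSublevel.
Variable R : realType.

(** A qualitative form of Lagrange interpolation: [D + 1] separated points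
    control a polynomial of degree at most [D].  By induction on [D]: the
    quotient of [p - p.[x]] by ['X - x], for [x] the last point, is small at the
    other points, as its denominator there is at least [eta].  The uniformity in
    [p] lets all the lines in a given direction, on which a multivariate
    polynomial has unrelated restrictions, be treated with the same [eps]. *)
Lemma poly_small_at_separated_points (D : nat) (B eta e : R) :
  0 <= B -> 0 < eta -> 0 < e -> exists2 eps : R, 0 < eps &
  forall (p : {poly R}) (t : nat -> R) (u : R), (size p <= D.+1)%N ->
    (forall i, (i <= D)%N -> `|u - t i| <= B) ->
    (forall i j, (i < j <= D)%N -> eta <= `|t i - t j|) ->
    (forall i, (i <= D)%N -> `|p.[t i]| <= eps) -> `|p.[u]| <= e.
Proof.
move=> B_ge0 eta_gt0; elim: D e => [|D IHD] e e_gt0.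
  exists e => // p t u size_p _ _ /(_ 0 isT).
  by rewrite (size1_polyC size_p) !hornerC.
have B1_gt0 : 0 < 2 * (B + 1) by lra.
have [eps' eps'_gt0 IH] := IHD (e / (2 * (B + 1))) (divr_gt0 e_gt0 B1_gt0).
exists (Num.min (e / 2) (eps' * eta / 2)) => [|p t u size_p le_B le_eta le_eps].
  by rewrite lt_min !divr_gt0 // mulr_gt0.
have {}le_eps i : (i <= D.+1)%N ->
    `|p.[t i]| <= e / 2 /\ `|p.[t i]| <= eps' * eta / 2.
  by move/le_eps; rewrite le_min => /andP.
have /factor_theorem[q def_q] : root (p - (p.[t D.+1])%:P) (t D.+1).
  by rewrite /root !hornerE subrr.
have p_q x : p.[x] = p.[t D.+1] + q.[x] * (x - t D.+1).
  have /(congr1 (horner^~ x)) := def_q; rewrite !hornerE => <-.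
  by rewrite addrC subrK.
have size_q : (size q <= D.+1)%N.
  have [->|q_neq0] := eqVneq q 0; first by rewrite size_poly0.
  rewrite -ltnS; have := size_Mmonic q_neq0 (monicXsubC (t D.+1)).
  rewrite size_XsubC addn2 /= => <-; rewrite -def_q.
  rewrite (leq_trans (size_polyD _ _)) // size_polyN geq_max size_p /=.
  by rewrite (leq_trans (size_polyC_leq1 _)).
have q_small i : (i <= D)%N -> `|q.[t i]| <= eps'.
  move=> le_iD; have dist := le_eta i D.+1 (_ : i < D.+1 <= D.+1)%N.
  have {}dist : eta <= `|t i - t D.+1| by apply: dist; rewrite ltnS le_iD leqnn.
  have [_ small1] := le_eps i (leqW le_iD).
  have [_ small2] := le_eps D.+1 (leqnn _).
  have : `|q.[t i]| * `|t i - t D.+1| <= eps' * eta.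
    rewrite -normrM; have -> : q.[t i] * (t i - t D.+1) = p.[t i] - p.[t D.+1].
      by rewrite (p_q (t i)) [_ + _ - _]addrAC subrr add0r.
    by apply: le_trans (ler_normB _ _) _; lra.
  move=> le1; rewrite -(ler_pM2r eta_gt0); apply: le_trans le1.
  by rewrite ler_wpM2l.
have qu : `|q.[u]| <= e / (2 * (B + 1)).
  apply: (IH q t u size_q) => // [i le_iD|i j /andP[lt_ij le_jD]].
    by apply: le_B; apply: leqW.
  by apply: le_eta; rewrite lt_ij leqW.
rewrite p_q; apply: le_trans (ler_normD _ _) _; rewrite normrM.
have [small _] := le_eps D.+1 (leqnn _).
have le2 : `|q.[u]| * `|u - t D.+1| <= e / (2 * (B + 1)) * (B + 1).
  apply: ler_pM => //; apply: le_trans (le_B D.+1 (leqnn _)) _; lra.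
have eq_e : e / (2 * (B + 1)) * (B + 1) = e / 2.
  by field; lra.
rewrite eq_e in le2; lra.
Qed.

Lemma sorted_ltn_nth_gap (s : seq nat) i k :
  sorted ltn s -> (i + k < size s)%N -> (nth 0 s i + k <= nth 0 s (i + k))%N.
Proof.
move=> s_sorted; elim: k => [|k IHk]; first by rewrite !addn0.
rewrite !addnS => lt_s; apply: leq_ltn_trans (IHk (ltnW lt_s)) _.
by apply: (sorted_ltn_nth ltn_trans) => //; rewrite inE ltnW.
Qed.

(** Taking every [L]-th element of [A] in increasing order. *)
Lemma separated_subfamily m (A : {set 'I_m}) (D L : nat) : (D * L < #|A|)%N ->
  exists a : nat -> 'I_m, (forall i, (i <= D)%N -> a i \in A) /\
    (forall i j, (i < j <= D)%N -> (a i + L <= a j)%N).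
Proof.
move=> lt_A; have [k0 k0_A] : exists k, k \in A.
  by apply/set0Pn; rewrite -card_gt0; apply: leq_ltn_trans lt_A.
have s_sorted : sorted ltn [seq val k | k <- enum A].
  rewrite sorted_map /enum_mem -enumT; apply: sorted_filter.
    by move=> x y z; apply: ltn_trans.
  by rewrite -sorted_map val_enum_ord iota_ltn_sorted.
have size_s : size [seq val k | k <- enum A] = #|A| by rewrite size_map -cardE.
have lt_s i : (i <= D)%N -> (i * L < size (enum A))%N.
  move=> le_iD; rewrite -cardE; apply: leq_ltn_trans lt_A.
  by rewrite leq_mul2r le_iD orbT.
exists (fun i => nth k0 (enum A) (i * L)).
split=> [i le_iD|i j /andP[lt_ij le_jD]].
  by rewrite -mem_enum mem_nth // lt_s.
rewrite -!(nth_map k0 0 val) ?lt_s ?(leq_trans (ltnW lt_ij)) //.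
have lt_j := lt_s j le_jD.
have -> : (j * L = i * L + (j - i) * L)%N by rewrite -mulnDl subnKC // ltnW.
apply: leq_trans (sorted_ltn_nth_gap s_sorted _).
  by rewrite leq_add2l leq_pmull // subn_gt0.
by rewrite -mulnDl subnKC ?(ltnW lt_ij) // size_s cardE.
Qed.

(** The points [grid M m k], for [k <= m], cut the interval from [-M] to [M]
    into [m] equal cells. *)
Definition grid (M : R) (m k : nat) : R := M * (2 * k%:R / m%:R - 1).

Lemma grid_norm_le (M : R) m k : 0 < M -> (0 < m)%N -> (k <= m)%N ->
  `|grid M m k| <= M.
Proof.
move=> M_gt0 m_gt0 le_km.
rewrite /grid normrM gtr0_norm // ger_pMr // ler_norml.
have ge0 : 0 <= k%:R / m%:R :> R by rewrite divr_ge0.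
have le1 : k%:R / m%:R <= 1 :> R by rewrite ler_pdivrMr ?ltr0n // mul1r ler_nat.
by rewrite -mulrA; apply/andP; split; lra.
Qed.

(** A polynomial that is not small at [u] is small on at most a proportion
    [1 / Q] of a fine grid: otherwise, [D + 1] of the grid points at which it is
    small could be chosen a fixed distance apart, whatever the mesh. *)
Lemma grid_sublevel_card (D : nat) (M u e : R) (Q : nat) :
  0 < M -> 0 < e -> (0 < Q)%N ->
  exists2 eps : R, 0 < eps & exists m0, forall m, (m0 <= m)%N ->
  forall p : {poly R}, (size p <= D.+1)%N -> e < `|p.[u]| ->
  (Q * #|[set k : 'I_m | (`|p.[grid M m k]| <= eps)%R]| <= m)%N.
Proof.
move=> M_gt0 e_gt0 Q_gt0.
(* More than [m / Q] grid points leave room for [D + 1] of them at index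
   distance [L = m %/ K], that is at distance about [2 * M / K]; rounding costs
   at most a factor 2, whence the separation [M / K]. *)
pose K := (Q * D.+1)%N; have K_gt0 : (0 < K)%N by rewrite muln_gt0 Q_gt0.
have eta_gt0 : 0 < M / K%:R by rewrite divr_gt0 // ltr0n.
have B_ge0 : 0 <= `|u| + M by rewrite addr_ge0 // ltW.
have [eps eps_gt0 small] :=
  poly_small_at_separated_points D B_ge0 eta_gt0 e_gt0.
exists eps => //; exists K => m le_Km p size_p e_lt.
rewrite leqNgt; apply/negP => lt_m; move: e_lt; apply/negP; rewrite -leNgt.
set A := [set k : 'I_m | _] in lt_m *.
have m_gt0 : (0 < m)%N := leq_trans K_gt0 le_Km.
pose L := (m %/ K)%N.
have L_gt0 : (0 < L)%N by rewrite divn_gt0.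
have m_lt : (m <= 2 * L * K)%N.
  rewrite (leq_trans (ltnW (ltn_ceil m K_gt0))) // leq_mul2r mul2n -addnn.
  by rewrite -addn1 leq_add2l L_gt0 orbT.
have lt_A : (D * L < #|A|)%N.
  rewrite -(ltn_pmul2l Q_gt0) (leq_ltn_trans _ lt_m) //.
  rewrite (leq_trans _ (leq_trunc_div m K)) // -/L.
  have -> : (L * K = Q * (D.+1 * L))%N by rewrite mulnC mulnA.
  by rewrite leq_mul2l leq_mul2r leqnSn !orbT.
have [a [a_A a_sep]] := separated_subfamily lt_A.
have m_neq0 : m%:R != 0 :> R by rewrite pnatr_eq0 -lt0n.
apply: (small p (fun i => grid M m (a i)) u size_p) => [i le_iD|i j ij|i le_iD].
- apply: le_trans (ler_normB _ _) _; rewrite lerD2l.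
  by rewrite grid_norm_le // ltnW.
- have sep := a_sep i j ij.
  have -> : grid M m (a i) - grid M m (a j) =
            - (2 * M * ((a j)%:R - (a i)%:R) / m%:R).
    by rewrite /grid; field.
  rewrite normrN -natrB ?(leq_trans _ sep) ?leq_addr //.
  rewrite ger0_norm; last by rewrite divr_ge0 ?mulr_ge0 // ltW.
  rewrite ler_pdivlMr ?ltr0n // mulrAC ler_pdivrMr ?ltr0n //.
  rewrite -!mulrA [2 * _]mulrCA ler_pM2l // -!natrM ler_nat.
  apply: leq_trans m_lt _; rewrite mulnA leq_mul2r leq_mul2l leq_subRL.
    by rewrite sep !orbT.
  by apply: leq_trans sep; rewrite leq_addr.
- by have := a_A i le_iD; rewrite inE.
Qed.

End UnivariateSublevel.

(** * Zero sets of multivariate polynomials are null *)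

Section PolynomialFunctions.
Variables (R : realType) (I : finType).
Implicit Types (f g : (I -> R) -> R) (u v w : I -> R).

(** Polynomial functions of the coordinates, as the closure of constants and
    coordinates under sums and products.  This form gives access to their
    analytic properties by induction. *)
Inductive polyfun : ((I -> R) -> R) -> Prop :=
| polyfun_cst c : polyfun (fun=> c)
| polyfun_coord i : polyfun (fun v => v i)
| polyfun_add f g : polyfun f -> polyfun g -> polyfun (fun v => f v + g v)
| polyfun_mul f g : polyfun f -> polyfun g -> polyfun (fun v => f v * g v).

Lemma polyfun_sum (J : finType) (F : J -> (I -> R) -> R) :
  (forall j, polyfun (F j)) -> polyfun (fun v => \sum_j F j v).
Proof.
move=> polyF; elim: (index_enum J) => [|j s IHs].
  by under eq_fun do rewrite big_nil; apply: polyfun_cst.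
by under eq_fun do rewrite big_cons; apply: polyfun_add.
Qed.

Lemma polyfun_prod (J : finType) (F : J -> (I -> R) -> R) :
  (forall j, polyfun (F j)) -> polyfun (fun v => \prod_j F j v).
Proof.
move=> polyF; elim: (index_enum J) => [|j s IHs].
  by under eq_fun do rewrite big_nil; apply: polyfun_cst.
by under eq_fun do rewrite big_cons; apply: polyfun_mul.
Qed.

Lemma polyfun_det m (A : (I -> R) -> 'M[R]_m) :
  (forall i j, polyfun (fun v => A v i j)) -> polyfun (fun v => \det (A v)).
Proof.
move=> polyA; apply: polyfun_sum => s.
by apply: polyfun_mul; [apply: polyfun_cst | apply: polyfun_prod].
Qed.

Lemma polyfun_line f : polyfun f -> exists D, forall v i,
  exists2 p : {poly R}, (size p <= D.+1)%N &
    forall t, f [eta v with i |-> t] = p.[t].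
Proof.
elim=> {f} [c|j|f g _ [D fD] _ [E gE]|f g _ [D fD] _ [E gE]].
- exists 0 => v i; exists c%:P => [|t]; last by rewrite hornerC.
  exact: size_polyC_leq1.
- exists 1 => v i; exists (if j == i then 'X else (v j)%:P) => [|t] /=.
    by case: ifP => _; rewrite ?size_polyX // (leq_trans (size_polyC_leq1 _)).
  by case: ifP => _; rewrite ?hornerX ?hornerC.
- exists (maxn D E) => v i.
  have [p p_size pE] := fD v i; have [q q_size qE] := gE v i.
  exists (p + q) => [|t]; last by rewrite hornerD pE qE.
  rewrite (leq_trans (size_polyD _ _)) //.
  by rewrite -maxnSS geq_max !leq_max p_size q_size orbT.
- exists (D + E) => v i.
  have [p p_size pE] := fD v i; have [q q_size qE] := gE v i.
  exists (p * q) => [|t]; last by rewrite hornerM pE qE.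
  rewrite (leq_trans (size_polyMleq _ _)) //; lia.
Qed.

(** The bound on [f] is what makes the Lipschitz bound pass to products. *)
Lemma polyfun_lipschitz f (M : R) : polyfun f -> exists2 B : R * R,
  0 <= B.1 /\ 0 <= B.2 & forall v w delta,
    (forall i, `|v i| <= M) -> (forall i, `|w i| <= M) ->
    0 <= delta -> (forall i, `|v i - w i| <= delta) ->
    `|f v| <= B.1 /\ `|f v - f w| <= B.2 * delta.
Proof.
elim=> {f} [c|j|f g _ [[B L] /= [B0 L0] fB] _ [[C K] /= [C0 K0] gC]|
                f g _ [[B L] /= [B0 L0] fB] _ [[C K] /= [C0 K0] gC]].
- exists (`|c|, 0) => [|v w delta _ _ _ _] //=.
  by rewrite subrr normr0 mul0r.
- exists (`|M|, 1) => [|v w delta v_le _ _ vw_le] //=.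
  by rewrite mul1r (le_trans (v_le j)) ?ler_norm.
- exists (B + C, L + K) => /= [|v w delta v_le w_le d_ge0 vw_le].
    by rewrite !addr_ge0.
  have [fv fvw] := fB v w delta v_le w_le d_ge0 vw_le.
  have [gv gvw] := gC v w delta v_le w_le d_ge0 vw_le.
  split; first by rewrite (le_trans (ler_normD _ _)) ?lerD.
  by rewrite opprD addrACA mulrDl (le_trans (ler_normD _ _)) ?lerD.
- exists (B * C, L * C + B * K) => /= [|v w delta v_le w_le d_ge0 vw_le].
    by split; rewrite ?addr_ge0 ?mulr_ge0.
  have [fv fvw] := fB v w delta v_le w_le d_ge0 vw_le.
  have [gv gvw] := gC v w delta v_le w_le d_ge0 vw_le.
  have wv_le i : `|w i - v i| <= delta by rewrite distrC.
  have [gw _] := gC w v delta w_le v_le d_ge0 wv_le.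
  split; first by rewrite normrM ler_pM.
  have -> : f v * g v - f w * g w = (f v - f w) * g w + f v * (g v - g w).
    by ring.
  rewrite (le_trans (ler_normD _ _)) // !normrM mulrDl lerD //.
    by rewrite mulrAC ler_pM.
  by rewrite -mulrA ler_pM.
Qed.

End PolynomialFunctions.

Section GridCounting.
Variable I : finType.

Definition grid_upd m (g : {ffun I -> 'I_m}) (i : I) (k : 'I_m) :
    {ffun I -> 'I_m} :=
  [ffun j => if j == i then k else g j].

(** Discrete Fubini: a set of grid points has proportion at most [1 / Q] if it
    meets every line in direction [i] in such a proportion.  Each line is
    parametrized by all of its [m] points [g], whence the double counting of
    pairs [(g, k)] through an involution. *)
Lemma card_by_fibers m (i : I) (A : {set {ffun I -> 'I_m}}) (Q : nat) :
  (forall g, (Q * #|[set k | grid_upd g i k \in A]| <= m)%N) ->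
  (Q * #|A| <= m ^ #|I|)%N.
Proof.
move=> le_fib.
have [m0|m_gt0] := posnP m.
  have I_gt0 : (0 < #|I|)%N by apply/card_gt0P; exists i.
  have m_exp : (m ^ #|I| = 0)%N by rewrite m0 exp0n.
  have := max_card A; rewrite card_ffun card_ord m_exp leqn0 => /eqP->.
  by rewrite muln0.
rewrite -(leq_pmul2r m_gt0).
pose swap (x : {ffun I -> 'I_m} * 'I_m) := (grid_upd x.1 i x.2, x.1 i).
have swapK : involutive swap.
  case=> g k; rewrite /swap /= ffunE eqxx; congr pair; apply/ffunP=> j.
  by rewrite !ffunE; case: eqP => // ->.
have -> : (Q * #|A| * m = \sum_g Q * #|[set k | grid_upd g i k \in A]|)%N.
  rewrite -big_distrr /= -mulnA; congr muln.
  transitivity (\sum_(x : {ffun I -> 'I_m} * 'I_m) (x.1 \in A))%N.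
    rewrite -sum1_card big_distrl /= big_mkcond /=.
    rewrite -(pair_bigA _ (fun g _ => (g \in A : nat))) /=.
    apply: eq_bigr => g _.
    rewrite sum_nat_const card_ord.
    by case: (g \in A); rewrite ?mul1n ?muln1 ?muln0.
  rewrite (reindex_inj (inv_inj swapK)) /=.
  rewrite -(pair_bigA _ (fun g k => (grid_upd g i k \in A : nat))) /=.
  apply: eq_bigr => g _; rewrite -sum1_card [RHS]big_mkcond /=.
  by apply: eq_bigr => k _; rewrite inE; case: (_ \in _).
apply: (@leq_trans (\sum_(g : {ffun I -> 'I_m}) m)).
  by apply: leq_sum => g _; apply: le_fib.
by rewrite sum_nat_const card_ffun card_ord.
Qed.

End GridCounting.

Section ZeroSets.
Variables (R : realType) (I : finType).
Implicit Types (f : (I -> R) -> R) (u v : I -> R).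

Definition mix u (s : seq I) v : I -> R :=
  fun i => if i \in s then v i else u i.

(** Induction on the set of free coordinates.  When [i] is released, a grid
    point at which [f] is small either was already one at which [f] is small
    with [i] frozen, or lies on a line in direction [i] along which [f] is not
    small at [u i]; on such a line [grid_sublevel_card] applies with constants
    that are the same for all lines.  Each case gets half of the budget. *)
Lemma polyfun_grid_sublevel f u (M : R) : polyfun f -> f u != 0 -> 0 < M ->
  forall (s : seq I), uniq s -> forall Q, (0 < Q)%N ->
  exists2 eps : R, 0 < eps & exists m0, forall m, (m0 <= m)%N ->
  (Q * #|[set g : {ffun I -> 'I_m} |
          (`|f (mix u s (fun i => grid M m (g i)))| <= eps)%R]| <= m ^ #|I|)%N.
Proof.
move=> f_poly fu_neq0 M_gt0.
elim=> [_ Q _|i s IHs /= /andP[i_notin s_uniq] Q Q_gt0].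
  exists (`|f u| / 2); first by rewrite divr_gt0 ?normr_gt0.
  exists 0 => m _; rewrite (_ : [set g | _] = finset.set0) ?cards0 ?muln0 //.
  apply/setP=> g; rewrite !inE /mix /=; apply/negbTE; rewrite -ltNge.
  have : 0 < `|f u| by rewrite normr_gt0.
  by rewrite (_ : (fun _ => _) = u) //; lra.
have Q2_gt0 : (0 < 2 * Q)%N by rewrite muln_gt0.
have [e1 e1_gt0 [m1 IH]] := IHs s_uniq (2 * Q)%N Q2_gt0.
have [D lineD] := polyfun_line f_poly.
have [e2 e2_gt0 [m2 fib]] := grid_sublevel_card D (u i) M_gt0 e1_gt0 Q2_gt0.
exists e2 => //; exists (maxn m1 m2) => m.
rewrite geq_max => /andP[le_m1 le_m2].
set A := [set g | _]; set A1 := [set g : {ffun I -> 'I_m} |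
  (`|f (mix u s (fun i => grid M m (g i)))| <= e1)%R].
suff le_D : (2 * Q * #|A :\: A1| <= m ^ #|I|)%N.
  have le_A : (#|A| <= #|A1| + #|A :\: A1|)%N.
    by rewrite -(cardsID A1 A) leq_add2r subset_leq_card // subsetIr.
  have := IH m le_m1; rewrite -/A1; move: le_A le_D.
  move: #|A| #|A1| #|A :\: A1| (m ^ #|I|)%N => a b c k; nia.
apply: (card_by_fibers (i := i)) => g.
have [p p_size pE] := lineD (mix u (i :: s) (fun i => grid M m (g i))) i.
have line k :
    f (mix u (i :: s) (fun j => grid M m (grid_upd g i k j))) = p.[grid M m k].
  rewrite -pE; congr f; apply/funext => j; rewrite /mix /= inE ffunE.
  by case: eqP.
have base k : f (mix u s (fun j => grid M m (grid_upd g i k j))) = p.[u i].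
  rewrite -pE; congr f; apply/funext => j; rewrite /mix /= inE ffunE.
  by case: eqP => // ->; rewrite (negbTE i_notin).
have [lt_e|ge_e] := ltP e1 `|p.[u i]|.
  apply: leq_trans (fib m le_m2 p p_size lt_e).
  rewrite leq_mul2l; apply/orP; right.
  apply: subset_leq_card; apply/fintype.subsetP => k; rewrite !inE line.
  by case/andP.
rewrite (_ : [set k | _] = finset.set0) ?cards0 ?muln0 //.
by apply/setP=> k; rewrite !inE base ge_e.
Qed.

Lemma grid_succ (M : R) m k : grid M m k.+1 - grid M m k = 2 * M / m%:R.
Proof. by rewrite /grid -natr1; ring. Qed.

Lemma grid_cell (M x : R) m : 0 < M -> (0 < m)%N -> `|x| < M ->
  exists k : 'I_m, grid M m k <= x <= grid M m k.+1.
Proof.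
move=> M_gt0 m_gt0; rewrite ltr_norml => /andP[x_gt x_lt].
have m_gt0R : 0 < m%:R :> R by rewrite ltr0n.
pose y := (x / M + 1) * m%:R / 2.
have xM_gt : -1 < x / M by rewrite ltr_pdivlMr // mulN1r.
have xM_lt : x / M < 1 by rewrite ltr_pdivrMr // mul1r.
have y_ge0 : 0 <= y by rewrite divr_ge0 ?mulr_ge0 //; lra.
have y_lt : y < m%:R.
  by rewrite /y ltr_pdivrMr // [ltRHS]mulrC ltr_pM2r //; lra.
have gridE t : grid M m t <= x = (t%:R <= y) /\ x <= grid M m t = (y <= t%:R).
  have -> : x = M * (2 * y / m%:R - 1) by rewrite /y; field; rewrite !gt_eqF.
  rewrite /grid !ler_pM2l // !lerD2r !ler_pM2r ?invr_gt0 // !ler_pM2l //.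
have k_lt : (Num.trunc y < m)%N.
  by rewrite -(ltr_nat R) (le_lt_trans _ y_lt) // truncn_le.
exists (Ordinal k_lt); rewrite !(gridE _).1 !(gridE _).2 /= truncn_le y_ge0.
exact: ltW (truncnS_gt _).
Qed.

(** The set is exhausted by bounded parts [A M]; the part in a cube is covered
    by the cells of a fine grid whose lower corner is a point at which [|f|] is
    at most [eps], a bound that the Lipschitz constant [L] guarantees as soon as
    the mesh [delta] satisfies [L * delta <= eps]. *)
Theorem polyfun_zeros_null f u : I -> polyfun f -> f u != 0 ->
  lebesgue_outer [set v | f v = 0]%classic = 0%E.
Proof.
move=> i0 f_poly fu_neq0.
pose A (M : nat) : set (I -> R) :=
  [set v | f v = 0 /\ forall i, `|v i| < M.+1%:R]%classic.
have -> : [set v | f v = 0]%classic = (\bigcup_M A M)%classic.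
  apply/seteqP; split=> [v /= fv0|v [M _ []] //].
  exists (Num.trunc (\sum_i `|v i|)) => //; split=> // i.
  apply: le_lt_trans (truncnS_gt _).
  by rewrite (bigD1 i) //= lerDl sumr_ge0.
apply: (lebesgue_outer_bigcup_eq0 i0) => M e e_gt0.
have M_gt0 : 0 < M.+1%:R :> R by rewrite ltr0n.
set M' : R := M.+1%:R in M_gt0.
pose V := (2 * M') ^+ #|I|.
have V_gt0 : 0 < V by rewrite exprn_gt0 ?mulr_gt0.
pose Q := (Num.trunc (V / e)).+1.
have [eps eps_gt0 [m0 count]] := polyfun_grid_sublevel f_poly fu_neq0 M_gt0
  (enum_uniq I) (ltn0Sn (Num.trunc (V / e))).
have [[B L] /= [_ L_ge0] lipf] := polyfun_lipschitz M' f_poly.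
pose m := maxn m0 (Num.trunc (L * (2 * M') / eps)).+1.
have m_gt0 : (0 < m)%N by rewrite /m leq_max orbT.
have m_gt0R : 0 < m%:R :> R by rewrite ltr0n.
have m_neq0 : m%:R != 0 :> R by rewrite gt_eqF.
pose delta := 2 * M' / m%:R.
have delta_gt0 : 0 < delta by rewrite divr_gt0 ?mulr_gt0.
have L_delta : L * delta <= eps.
  rewrite /delta mulrA ler_pdivrMr // -ler_pdivrMl // mulrC.
  apply: ltW; apply: lt_le_trans (truncnS_gt _) _.
  by rewrite ler_nat /m leq_maxr.
pose lo (g : {ffun I -> 'I_m}) : I -> R := fun i => grid M' m (g i).
pose hi (g : {ffun I -> 'I_m}) : I -> R := fun i => grid M' m (g i).+1.
have mix_enum v : mix u (enum I) v = v.
  by apply/funext => i; rewrite /mix mem_enum.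
pose G := [set g : {ffun I -> 'I_m} | `|f (lo g)| <= eps].
exists [seq (lo g, hi g) | g <- enum G]; split.
- move=> k i; have [lt_k|ge_k] := ltnP k (size (enum G)).
    rewrite (nth_map [ffun=> Ordinal m_gt0]) //= -subr_ge0 grid_succ ltW //.
  by rewrite nth_default ?size_map.
- move=> v [fv0 v_lt].
  have [g g_v] := choice (fun i => grid_cell M_gt0 m_gt0 (v_lt i)).
  have Gg : finfun g \in G.
    have lo_le i : `|lo (finfun g) i| <= M' by rewrite grid_norm_le // ltnW.
    have dist i : `|lo (finfun g) i - v i| <= delta.
      have /andP[lo_v v_hi] := g_v i.
      rewrite /lo ffunE distrC ger0_norm ?subr_ge0 //.
      by rewrite /delta -(grid_succ M' m (g i)) lerD2r.
    have v_le i : `|v i| <= M' := ltW (v_lt i).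
    have [_] := lipf _ v delta lo_le v_le (ltW delta_gt0) dist.
    by rewrite fv0 subr0 inE => /le_trans; apply.
  exists (index (finfun g) (enum G)).
    by rewrite size_map index_mem mem_enum.
  rewrite (nth_map [ffun=> Ordinal m_gt0]) ?index_mem ?mem_enum //.
  rewrite nth_index ?mem_enum // => i; rewrite /lo /hi /= ffunE; exact: g_v.
- have le_G : (Q * #|G| <= m ^ #|I|)%N.
    apply: leq_trans (count m (leq_maxl _ _)).
    rewrite leq_mul2l; apply/orP; right; apply: subset_leq_card.
    by apply/fintype.subsetP => g; rewrite !inE mix_enum.
  rewrite big_map big_enum /= (eq_bigr (fun=> delta ^+ #|I|)); last first.
    move=> g _; rewrite /vol (eq_bigr (fun=> delta)) ?prodr_const //.
    by move=> i _; exact: grid_succ.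
  rewrite sumr_const -mulr_natl expr_div_n -/V mulrA ler_pdivrMr ?exprn_gt0 //.
  have le_V : V <= e * Q%:R.
    by rewrite -ler_pdivrMl // mulrC ltW // truncnS_gt.
  apply: (@le_trans _ _ (#|G|%:R * (e * Q%:R))); first by rewrite ler_wpM2l.
  by rewrite mulrCA ler_pM2l // -natrM -natrX ler_nat mulnC.
Qed.

End ZeroSets.

(** * Cutting a tensor train at a bond *)

Lemma matricizeE (R : realType) m1 m2 m3 (A : 'I_m1 -> 'I_m2 -> 'I_m3 -> R)
    a b c :
  matricize A a (mxvec_index b c) = A a b c.
Proof. by rewrite mxE mxvecE mxE. Qed.

Section Matricization.
Variables (R : realType) (m1 m2 m3 : nat).
Implicit Type A : 'I_m1 -> 'I_m2 -> 'I_m3 -> R.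

Lemma eq_matricize A A' :
  (forall a b c, A a b c = A' a b c) -> matricize A = matricize A'.
Proof.
move=> eqA; apply/matrixP => a k; case/mxvec_indexP: k => b c.
by rewrite !matricizeE.
Qed.

Lemma rank_matricize_le A s (alpha : 'I_m1 -> 'I_s -> R)
    (beta : 'I_s -> 'I_m2 -> 'I_m3 -> R) :
  (forall a b c, A a b c = \sum_l alpha a l * beta l b c) ->
  (\rank (matricize A) <= s)%N.
Proof.
move=> A_eq.
have -> : matricize A = (\matrix_(a, l) alpha a l) *m matricize beta.
  apply/matrixP => a k; case/mxvec_indexP: k => b c.
  rewrite matricizeE A_eq mxE.
  by apply: eq_bigr => l _; rewrite mxE matricizeE.
exact: leq_trans (mxrankM_maxl _ _) (rank_leq_col _).
Qed.

Lemma rank_mxsub_le m n m' n' (f : 'I_m' -> 'I_m) (g : 'I_n' -> 'I_n)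
    (M : 'M[R]_(m, n)) :
  (\rank (mxsub f g M) <= \rank M)%N.
Proof.
rewrite -{1}[M]mul1mx mxsub_mul -{1}[M]mulmx1 -mulmx_colsub.
exact: leq_trans (mxrankM_maxr _ _) (mxrankM_maxl _ _).
Qed.

End Matricization.

Section TensorTrains.
Variables (R : realType) (d : nat) (n r : 'I_d.+1 -> nat) (tau : 'S_d.+1).
Implicit Types (u : core_space R n r tau) (x y : multi_index n).
Local Notation mode k := (tau (inZp k)).
Local Notation pos i := (val ((tau^-1)%g i)).

Lemma pos_mode k : (k <= d)%N -> pos (mode k) = k.
Proof. by move=> le_kd; rewrite permK /= modn_small. Qed.

Lemma mode_pos i : mode (pos i) = i.
Proof. by rewrite valZpK permKV. Qed.

Lemma pos_le i : (pos i <= d)%N.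
Proof. by rewrite -ltnS ltn_ord. Qed.

Lemma eq_factor u x x' k : x (mode k) = x' (mode k) ->
  Defs.factor u x k = Defs.factor u x' k.
Proof. by rewrite /Defs.factor => ->. Qed.

Lemma eq_factor_prod u x x' k :
  (forall j, (j < k)%N -> x (mode j) = x' (mode j)) ->
  factor_prod u x k = factor_prod u x' k.
Proof.
elim: k => //= k IHk eq_x; rewrite IHk ?(eq_factor u (eq_x k _)) // => j lt_jk.
by apply: eq_x; apply: leqW.
Qed.

(** The product of the factors at positions [k], ..., [l - 1] is obtained by
    induction on [l], together with the fact that it only sees the coordinates
    at these positions. *)
Lemma factor_prod_split u k l : (k <= l)%N ->
  exists2 G : multi_index n -> 'M[R]_(bond r k, bond r l),
    forall x, factor_prod u x l = factor_prod u x k *m G x &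
    forall x x', (forall j, (k <= j < l)%N -> x (mode j) = x' (mode j)) ->
      G x = G x'.
Proof.
elim: l => [|l IHl].
  by rewrite leqn0 => /eqP->; exists (fun=> 1%:M) => // x; rewrite mulmx1.
rewrite leq_eqVlt => /predU1P[->|].
  by exists (fun=> 1%:M) => // x; rewrite mulmx1.
rewrite ltnS => le_kl; have [G prodG eqG] := IHl le_kl.
exists (fun x => G x *m Defs.factor u x l) => [x|x x' eq_x].
  by rewrite /= prodG mulmxA.
rewrite (eqG x x') ?(eq_factor u (x' := x')) // => [|j /andP[le_kj lt_jl]].
  by apply: eq_x; rewrite le_kl ltnSn.
by apply: eq_x; rewrite le_kj leqW.
Qed.

Hypothesis r1 : r ord0 = 1%N.

Definition bond_first : 'I_(bond r 0) := cast_ord (esym (bond_ends r1).1) ord0.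
Definition bond_last : 'I_(bond r d.+1) :=
  cast_ord (esym (bond_ends r1).2) ord0.

Lemma phiE u x : phi r1 u x = factor_prod u x d.+1 bond_first bond_last.
Proof. by rewrite /phi castmxE. Qed.

Lemma phi_split u k : (k <= d.+1)%N ->
  exists2 G : multi_index n -> 'I_(bond r k) -> R,
    forall x, phi r1 u x = \sum_c factor_prod u x k bond_first c * G x c &
    forall x x', (forall j, (k <= j < d.+1)%N -> x (mode j) = x' (mode j)) ->
      G x = G x'.
Proof.
move=> le_k; have [G prodG eqG] := factor_prod_split u le_k.
exists (fun x c => G x c bond_last) => [x|x x' eq_x].
  by rewrite phiE prodG mxE.
by rewrite (eqG x x').
Qed.

(** The row index acts only to the left of the bond [k] and the column indices
    only to its right, so cutting the train at [k] factors the matrix through a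
    space of dimension [bond r k]. *)
Lemma rank_left_of_bond u k m1 m2 m3
    (X : 'I_m1 -> 'I_m2 -> 'I_m3 -> multi_index n) :
  (0 < m1)%N -> (0 < m2)%N -> (0 < m3)%N -> (k <= d.+1)%N ->
  (forall a b c b' c' j, (j < k)%N -> X a b c (mode j) = X a b' c' (mode j)) ->
  (forall a a' b c j, (k <= j < d.+1)%N ->
     X a b c (mode j) = X a' b c (mode j)) ->
  (\rank (matricize (fun a b c => phi r1 u (X a b c))) <= bond r k)%N.
Proof.
move=> m1_gt0 m2_gt0 m3_gt0 le_k X_left X_right.
pose a0 := Ordinal m1_gt0; pose b0 := Ordinal m2_gt0; pose c0 := Ordinal m3_gt0.
have [G phiG eqG] := phi_split u le_k.
apply: (@rank_matricize_le _ _ _ _ _ _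
  (fun a l => factor_prod u (X a b0 c0) k bond_first l)
  (fun l b c => G (X a0 b c) l)).
move=> a b c; rewrite phiG; apply: eq_bigr => l _; congr (_ * _).
  by rewrite (eq_factor_prod u (x' := X a b0 c0)) // => j /X_left; apply.
by rewrite (eqG _ (X a0 b c)) // => j /X_right; apply.
Qed.

Lemma rank_right_of_bond u k m1 m2 m3
    (X : 'I_m1 -> 'I_m2 -> 'I_m3 -> multi_index n) :
  (0 < m1)%N -> (0 < m2)%N -> (0 < m3)%N -> (k <= d.+1)%N ->
  (forall a a' b c j, (j < k)%N -> X a b c (mode j) = X a' b c (mode j)) ->
  (forall a b c b' c' j, (k <= j < d.+1)%N ->
     X a b c (mode j) = X a b' c' (mode j)) ->
  (\rank (matricize (fun a b c => phi r1 u (X a b c))) <= bond r k)%N.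
Proof.
move=> m1_gt0 m2_gt0 m3_gt0 le_k X_left X_right.
pose a0 := Ordinal m1_gt0; pose b0 := Ordinal m2_gt0; pose c0 := Ordinal m3_gt0.
have [G phiG eqG] := phi_split u le_k.
apply: (@rank_matricize_le _ _ _ _ _ _
  (fun a l => G (X a b0 c0) l)
  (fun l b c => factor_prod u (X a0 b c) k bond_first l)).
move=> a b c; rewrite phiG; apply: eq_bigr => l _; rewrite mulrC; congr (_ * _).
  by rewrite (eqG _ (X a b0 c0)) // => j /X_right; apply.
by rewrite (eq_factor_prod u (x' := X a0 b c)) // => j /X_left; apply.
Qed.

End TensorTrains.

(** * Matricizations along an outer mode *)

Section Slices.
Variables (d : nat) (n : 'I_d.+1 -> nat).
Variables (i j l : 'I_d.+1).
Hypothesis ijl_uniq : uniq [:: i; j; l].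
Implicit Types (y : multi_index n).

Definition slice_index y (a : 'I_(n i)) (b : 'I_(n j)) (c : 'I_(n l)) :
    multi_index n :=
  dfwith (dfwith (dfwith y a) b) c.

Let neqs : [/\ i != j, i != l & j != l].
Proof. by move: ijl_uniq; rewrite /= !inE negb_or andbT => /andP[/andP[]]. Qed.

Lemma slice_index1 y a b c : slice_index y a b c i = a.
Proof.
have [ij il jl] := neqs; rewrite /slice_index.
rewrite dfwith_out; last by rewrite eq_sym.
by rewrite dfwith_out ?dfwith_in // eq_sym.
Qed.

Lemma slice_index2 y a b c : slice_index y a b c j = b.
Proof.
have [ij il jl] := neqs; rewrite /slice_index.
by rewrite dfwith_out ?dfwith_in // eq_sym.
Qed.

Lemma slice_index3 y a b c : slice_index y a b c l = c.
Proof. exact: dfwith_in. Qed.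

Lemma slice_index_out y a b c m :
  m \notin [:: i; j; l] -> slice_index y a b c m = y m.
Proof.
rewrite !inE !negb_or => /and3P[mi mj ml]; rewrite /slice_index.
by rewrite !dfwith_out // eq_sym.
Qed.

Lemma slice_index_not1 y a a' b c m :
  m != i -> slice_index y a b c m = slice_index y a' b c m.
Proof.
move=> mi; have [->|ml] := eqVneq m l; first by rewrite !slice_index3.
have [->|mj] := eqVneq m j; first by rewrite !slice_index2.
by rewrite !slice_index_out // !inE !negb_or mi mj.
Qed.

Lemma slice_index_not23 y a b c b' c' m : m != j -> m != l ->
  slice_index y a b c m = slice_index y a b' c' m.
Proof.
move=> mj ml; have [->|mi] := eqVneq m i; first by rewrite !slice_index1.
by rewrite !slice_index_out // !inE !negb_or mi mj.
Qed.

End Slices.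

(** The order in which the three coordinates are overwritten does not matter,
    so all three matricizations are of one kind, with the row mode first. *)
Lemma slice_rot (R : realType) d (n : 'I_d.+1 -> nat) (T : tensor R n)
    (y : multi_index n) (i j l : 'I_d.+1)
    (a : 'I_(n i)) (b : 'I_(n j)) (c : 'I_(n l)) :
  uniq [:: i; j; l] -> slice T y a b c = slice T y b c a.
Proof.
move=> u1; have u2 : uniq [:: j; l; i] by rewrite -(rot_uniq 1) in u1.
apply: (congr1 T (_ : slice_index y a b c = slice_index y b c a)).
apply: functional_extensionality_dep => m.
have [->|mi] := eqVneq m i; first by rewrite slice_index1 // slice_index3.
have [->|mj] := eqVneq m j; first by rewrite slice_index2 // slice_index1.
have [->|ml] := eqVneq m l; first by rewrite slice_index3 slice_index2.
by rewrite !slice_index_out // !inE !negb_or mi mj ml.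
Qed.

Section OuterModes.
Variables (R : realType) (d : nat) (n r : 'I_d.+1 -> nat) (tau : 'S_d.+1).
Hypothesis n_gt0 : forall i, (0 < n i)%N.
Hypothesis r1 : r ord0 = 1%N.
Variable s : nat.
Hypothesis r_lt : forall j : 'I_d.+1, j != ord0 -> (r j < s)%N.
Local Notation mode k := (tau (inZp k)).
Local Notation pos i := (val ((tau^-1)%g i)).

Lemma bond_lt k : (0 < k <= d)%N -> (bond r k < s)%N.
Proof.
case/andP=> k_gt0 le_kd; apply: r_lt; apply/eqP => /(congr1 val) /=.
by rewrite modn_small // => k0; rewrite k0 in k_gt0.
Qed.

(** A row mode that comes before the two column modes is cut off by the bond on
    its right, one that comes after them by the bond on its left. *)
Lemma sigma_slice_outer (u : core_space R n r tau) y i j l :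
  uniq [:: i; j; l] ->
  ~~ correct_order tau (j, i, l) ->
  sigma s (matricize (@slice R d n (phi r1 u) y i j l)) = 0.
Proof.
move=> ijl_uniq not_mid; apply: sigma_eq0.
have outer : ((pos i < pos j)%N && (pos i < pos l)%N) ||
             ((pos j < pos i)%N && (pos l < pos i)%N).
  have pos_neq m : i != m -> (tau^-1)%g i != (tau^-1)%g m :> nat.
    by apply: contra_neq => /val_inj/perm_inj.
  move: ijl_uniq not_mid; rewrite /correct_order /= !inE negb_or andbT.
  by case/andP=> /andP[/pos_neq + /pos_neq +] _; lia.
have neq_mode k m : (k < d.+1)%N -> k != pos m -> mode k != m.
  by move=> le_kd; apply: contra_neq => <-; rewrite pos_mode.
case/orP: outer => /andP[lt_j lt_l].
  apply: (@leq_ltn_trans (bond r (pos i).+1)); last first.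
    by apply: bond_lt; rewrite /= (leq_trans lt_j) ?pos_le.
  apply: (rank_left_of_bond r1 u (X := fun a b c => slice_index y a b c)) => //.
  - exact: pos_le.
  - move=> a b c b' c' k; rewrite ltnS => le_k.
    have le_ki := leq_ltn_trans le_k.
    have k_lt : (k < d.+1)%N by rewrite ltnS (leq_trans le_k) ?pos_le.
    by apply: slice_index_not23; rewrite ?neq_mode // neq_ltn le_ki.
  - move=> a a' b c k /andP[lt_k k_lt].
    by apply: slice_index_not1; rewrite ?neq_mode // neq_ltn lt_k orbT.
apply: (@leq_ltn_trans (bond r (pos i))); last first.
  by apply: bond_lt; rewrite (leq_ltn_trans _ lt_j) ?pos_le.
apply: (rank_right_of_bond r1 u (X := fun a b c => slice_index y a b c)) => //.
- exact: leqW (pos_le _ _).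
- move=> a a' b c k lt_k.
  have k_lt : (k < d.+1)%N by exact: ltn_trans lt_k (ltn_ord _).
  by apply: slice_index_not1; rewrite ?neq_mode // neq_ltn lt_k.
- move=> a b c b' c' k /andP[le_k k_lt].
  apply: slice_index_not23; rewrite ?neq_mode //;
    by rewrite neq_ltn (leq_trans _ le_k) ?orbT.
Qed.

End OuterModes.

(** * Entries of a tensor train as polynomials in the cores *)

Section PolynomialEntries.
Variables (R : realType) (d : nat) (n r : 'I_d.+1 -> nat) (tau : 'S_d.+1).
Hypothesis r1 : r ord0 = 1%N.

Definition uncoords (v : Defs.coord n r tau -> R) : core_space R n r tau :=
  fun i x => \matrix_(a, b) v (Tagged _ (x, (a, b))).

Lemma coordsK (u : core_space R n r tau) : uncoords (coords u) = u.
Proof.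
apply: functional_extensionality_dep => i.
apply: functional_extensionality_dep => x.
by apply/matrixP => a b; rewrite mxE.
Qed.

Lemma uncoordsK (v : Defs.coord n r tau -> R) : coords (uncoords v) = v.
Proof.
apply: functional_extensionality_dep => -[i [x [a b]]].
by rewrite /coords mxE.
Qed.

Lemma polyfun_phi x : polyfun (fun v => phi r1 (uncoords v) x).
Proof.
have poly_factor k a b : polyfun (fun v => Defs.factor (uncoords v) x k a b).
  under eq_fun do rewrite castmxE mxE.
  exact: polyfun_coord.
under eq_fun do rewrite phiE.
elim: (d.+1) (bond_last r1) => [|k IHk] b /=.
  exact: polyfun_cst.
under eq_fun do rewrite mxE.
by apply: polyfun_sum => c; apply: polyfun_mul.
Qed.

End PolynomialEntries.

(** * Cores that realise an identity matrix *)

Section DeltaCores.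
Variables (R : realType) (d : nat) (n r : 'I_d.+1 -> nat) (tau : 'S_d.+1).
Hypothesis r_gt0 : forall j, (0 < r j)%N.
Hypothesis r1 : r ord0 = 1%N.
Variables (rho P Q S : nat).
Hypothesis rho_gt0 : (0 < rho)%N.
Hypothesis r_ge : forall j : 'I_d.+1, j != ord0 -> (rho <= r j)%N.
Hypotheses (lt_PQ : (P < Q)%N) (lt_QS : (Q < S)%N) (le_Sd : (S <= d)%N).
Local Notation mode k := (tau (inZp k)).

(** Cores of zeros and ones, with three distinguished positions [P < Q < S].
    The core at [P] writes its coordinate [x] into the bond on its right, the
    one at [S] checks that its coordinate is in the bond on its left, the one at
    [Q] checks that the two bonds contain the base [rho] digits of its
    coordinate, and all the others transmit the bond unchanged, whatever their
    coordinate. *)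
Definition delta_entry (k a b x : nat) : bool :=
  if k == P then (a == 0%N) && (b == x)
  else if k == Q then (a == x %/ rho)%N && (b == x %% rho)%N
  else if k == S then (a == x) && (b == 0%N)
  else a == b.

Definition delta_cores : core_space R n r tau :=
  fun i x => \matrix_(a, b) (delta_entry ((tau^-1)%g i) a b x)%:R.

(** Every partial product is either zero or a coordinate row vector: [hit]
    records the checks passed so far and [col] the value carried by the bond.
    The bonds on the way have dimension at least [rho], so the value fits. *)
Lemma phi_delta_cores (x : multi_index n) : (x (mode P) < rho)%N ->
  phi r1 delta_cores x =
    ((x (mode P) == x (mode Q) %/ rho :> nat)%N &&
     (x (mode Q) %% rho == x (mode S) :> nat)%N)%:R.
Proof.
move=> xP_lt.
have factorE k a b : (k <= d)%N -> Defs.factor delta_cores x k a b =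
    (delta_entry k a b (x (mode k)))%:R.
  move=> le_kd; rewrite castmxE mxE.
  by congr (nat_of_bool (delta_entry _ _ _ _))%:R; rewrite permK /= modn_small.
pose hit k := ((Q < k)%N ==> (x (mode P) == x (mode Q) %/ rho :> nat)%N) &&
  ((S < k)%N ==> (x (mode Q) %% rho == x (mode S) :> nat)%N).
pose col k : nat := if (k <= P)%N then 0%N
  else if (k <= Q)%N then val (x (mode P))
  else if (k <= S)%N then (x (mode Q) %% rho)%N else 0%N.
have col_lt k : (k <= d)%N -> (col k < bond r k)%N.
  move=> le_kd; have bond_ge : (0 < k)%N -> (rho <= bond r k)%N.
    move=> k_gt0; apply: r_ge; apply/eqP => /(congr1 val) /=.
    by rewrite modn_small // => k0; rewrite k0 in k_gt0.
  rewrite /col; case: (leqP k P) => [_|lt_Pk]; first exact: r_gt0.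
  have {}bond_ge := bond_ge (leq_ltn_trans (leq0n _) lt_Pk).
  case: ifP => _; first exact: leq_trans bond_ge.
  case: ifP => _; last exact: r_gt0.
  by rewrite (leq_trans _ bond_ge) ?ltn_pmod.
have prodE k c : (k <= d.+1)%N ->
    factor_prod delta_cores x k (bond_first r1) c =
    (hit k && (c == col k :> nat))%:R.
  elim: k c => [|k IHk] c lt_kd.
    rewrite /= /hit /col /= mxE; congr (nat_of_bool _)%:R.
    by rewrite -val_eqE.
  rewrite /= mxE (bigD1 (Ordinal (col_lt k lt_kd))) //= big1 => [|a a_neq].
    2: { rewrite IHk ?(ltnW lt_kd) // -val_eqE /= in a_neq *.
         by rewrite (negbTE a_neq) andbF mul0r. }
  rewrite IHk ?(ltnW lt_kd) // eqxx andbT addr0 factorE // -natrM mulnb /=.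
  congr (nat_of_bool _)%:R.
  rewrite /delta_entry /hit /col !ltnS.
  have x_at m : k = m -> x (mode k) = x (mode m) :> nat by move=> ->.
  case: (ltngtP k P) => cP; case: (ltngtP k Q) => cQ;
    case: (ltngtP k S) => cS; try (exfalso; lia);
    rewrite /= ?(x_at _ cP) ?(x_at _ cQ) ?(x_at _ cS) ?eqxx ?andbT ?andbA //;
    by rewrite [_ == nat_of_ord c]eq_sym.
have [d_leP d_leQ d_leS] :
  [/\ (d < P) = false, (d < Q) = false & (d < S) = false]%N by split; lia.
rewrite phiE prodE // /hit /col d_leP d_leQ d_leS.
by rewrite !ltnS (leq_trans (ltnW lt_QS)) // le_Sd /= andbT.
Qed.

End DeltaCores.

(** * Matricizations along the middle mode *)

Section MiddleMode.
Variables (R : realType) (d : nat) (n r : 'I_d.+1 -> nat) (tau : 'S_d.+1).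
Variable rho : nat.
Hypothesis r_gt0 : forall j, (0 < r j)%N.
Hypothesis r1 : r ord0 = 1%N.
Hypothesis rho_gt0 : (0 < rho)%N.
Hypothesis r_ge : forall j : 'I_d.+1, j != ord0 -> (rho <= r j)%N.
Hypothesis n_ge : forall i, (rho <= n i)%N.
Local Notation pos i := (val ((tau^-1)%g i)).

(** The columns run over pairs of coordinates below [rho], read as the base
    [rho] digits of [j], so that the delta cores give the identity matrix.  A
    single polynomial serves all [t] in the finite type [J]: the product of the
    minors, which is nonzero since the same cores work for every [t]. *)
Lemma generic_minor (J : finType)
    (X : J -> 'I_(rho ^ 2) -> 'I_(rho ^ 2) -> multi_index n)
    (iP iQ iS : 'I_d.+1) :
  (pos iP < pos iQ)%N -> (pos iQ < pos iS)%N ->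
  (forall t i j, [/\ X t i j iQ = i :> nat, X t i j iP = (j %/ rho)%N :> nat &
                     X t i j iS = (j %% rho)%N :> nat]) ->
  exists F : (Defs.coord n r tau -> R) -> R,
    [/\ polyfun F, exists v, F v != 0 &
        forall u, F (coords u) != 0 ->
        forall t, \det (\matrix_(i, j) phi r1 u (X t i j)) != 0].
Proof.
move=> lt_PQ lt_QS X_eq.
pose F (v : Defs.coord n r tau -> R) :=
  \prod_t \det (\matrix_(i, j) phi r1 (uncoords v) (X t i j)).
pose u0 := @delta_cores R d n r tau rho (pos iP) (pos iQ) (pos iS).
exists F; split.
- apply: polyfun_prod => t; apply: polyfun_det => i j.
  under eq_fun do rewrite mxE.
  exact: polyfun_phi.
- exists (coords u0); rewrite /F coordsK; apply/prodf_neq0 => t _.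
  suff -> : \matrix_(i, j) phi r1 u0 (X t i j) = 1%:M.
    by rewrite det1 oner_neq0.
  apply/matrixP => i j; rewrite !mxE; have [XQ XP XS] := X_eq t i j.
  have j_lt : (j %/ rho < rho)%N.
    by rewrite ltn_divLR // (leq_trans (ltn_ord j)) // mulnn.
  rewrite phi_delta_cores ?pos_le // !mode_pos ?XP // XQ XS.
  congr (nat_of_bool _)%:R; apply/andP/eqP => [[/eqP eq_div /eqP eq_mod]|->].
    by apply: val_inj; rewrite /= (divn_eq i rho) -eq_div eq_mod -divn_eq.
  by rewrite !eqxx.
- move=> u; rewrite /F coordsK => /prodf_neq0 det_neq0 t; exact: det_neq0.
Qed.

(** The leading digit of the column index goes to whichever of the two column
    modes comes first in the train. *)
Lemma sigma_slice_middle (iq ib ic : 'I_d.+1) : uniq [:: iq; ib; ic] ->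
  (rho ^ 2 <= n iq)%N ->
  correct_order tau (ib, iq, ic) ->
  exists F : (Defs.coord n r tau -> R) -> R,
    [/\ polyfun F, exists v, F v != 0 &
        forall u, F (coords u) != 0 ->
        forall y, 0 < sigma (rho ^ 2)
          (matricize (@slice R d n (phi r1 u) y iq ib ic))].
Proof.
move=> q_uniq nq_ge middle.
have div_lt (j : 'I_(rho ^ 2)) : (j %/ rho < rho)%N.
  by rewrite ltn_divLR // (leq_trans (ltn_ord j)) // mulnn.
have mod_lt (j : 'I_(rho ^ 2)) : (j %% rho < rho)%N by rewrite ltn_pmod.
pose hi i (j : 'I_(rho ^ 2)) : 'I_(n i) :=
  widen_ord (n_ge i) (Ordinal (div_lt j)).
pose lo i (j : 'I_(rho ^ 2)) : 'I_(n i) :=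
  widen_ord (n_ge i) (Ordinal (mod_lt j)).
pose row (i : 'I_(rho ^ 2)) : 'I_(n iq) := widen_ord nq_ge i.
(* Frozen multi-indices are encoded as finite functions to range over a
   finite type. *)
suff [[vb vc] /= [F [F_poly F_neq0 detF]]] :
  exists v : ('I_(rho ^ 2) -> 'I_(n ib)) * ('I_(rho ^ 2) -> 'I_(n ic)),
    exists F : (Defs.coord n r tau -> R) -> R,
    [/\ polyfun F, exists v, F v != 0 &
        forall u, F (coords u) != 0 -> forall t : {dffun forall i, 'I_(n i)},
          \det (\matrix_(i, j) phi r1 u
            (slice_index (t : multi_index n) (row i) (v.1 j) (v.2 j))) != 0].
  exists F; split=> // u Fu_neq0 y; rewrite sigma_gt0 ?expn_gt0 ?rho_gt0 //.
  pose col j := mxvec_index (vb j) (vc j).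
  apply: leq_trans (rank_mxsub_le row col _); rewrite (_ : mxsub _ _ _ =
    \matrix_(i, j) phi r1 u (slice_index y (row i) (vb j) (vc j))); last first.
    by apply/matrixP=> i j; rewrite !mxE mxvecE mxE.
  have := detF u Fu_neq0 (finfun y); have -> : (finfun y : multi_index n) = y.
    by apply: functional_extensionality_dep => i; rewrite ffunE.
  by rewrite -unitfE -unitmxE => /mxrank_unit ->.
case/orP: middle => /andP[lt1 lt2].
  exists (hi ib, lo ic); apply: (generic_minor lt1 lt2) => t i j /=.
  by rewrite slice_index1 // slice_index2 // slice_index3.
exists (lo ib, hi ic); apply: (generic_minor lt1 lt2) => t i j /=.
by rewrite slice_index1 // slice_index2 // slice_index3.
Qed.

End MiddleMode.

(** * Correctness of the algorithm *)

Theorem theorem4p8 (R : realType) (d : nat) (n r : 'I_d.+1 -> nat)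
    (n_gt0 : forall i, (0 < n i)%N) (r_gt0 : forall j, (0 < r j)%N)
    (r1 : r ord0 = 1%N) (tau : 'S_d.+1) (rho : nat) (rho_gt0 : (0 < rho)%N)
    (n_ends : (rho <= minn (n (tau ord0)) (n (tau ord_max)))%N)
    (n_mid : forall j : 'I_d.+1, j != ord0 -> j != ord_max ->
       (rho ^ 2 <= n (tau j))%N)
    (r_bounds : forall j : 'I_d.+1, j != ord0 -> (rho <= r j < rho ^ 2)%N)
    (i1 i2 i3 : 'I_d.+1) (i_uniq : uniq [:: i1; i2; i3]) :
  exists N : set (core_space R n r tau),
    lebesgue_null N /\
    forall u : core_space R n r tau, ~ N u ->
    forall y : multi_index n,
    exists o : 'I_d.+1 * 'I_d.+1 * 'I_d.+1,
      three_index rho i1 i2 i3 (phi r1 u) y = Some o /\ correct_order tau o.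
Proof.
pose pos i := val ((tau^-1)%g i).
have r_ge j : j != ord0 -> (rho <= r j)%N by case/r_bounds/andP.
have r_lt j : j != ord0 -> (r j < rho ^ 2)%N by case/r_bounds/andP.
have n_ge i : (rho <= n i)%N.
  rewrite -(permKV tau i); set j := (tau^-1)%g i.
  have [->|j_neq0] := eqVneq j ord0.
    exact: leq_trans n_ends (geq_minl _ _).
  have [->|j_neqm] := eqVneq j ord_max.
    exact: leq_trans n_ends (geq_minr _ _).
  apply: leq_trans (n_mid j j_neq0 j_neqm).
  by rewrite -{1}(expn1 rho) leq_pexp2l.
(* A mode between two others is not at an end of the train. *)
have n_ge_mid i b c :
    (pos b < pos i)%N -> (pos i < pos c)%N -> (rho ^ 2 <= n i)%N.
  move=> lt_bi lt_ic; rewrite -(permKV tau i); apply: n_mid.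
    by rewrite -val_eqE /= -lt0n (leq_ltn_trans _ lt_bi).
  by rewrite -val_eqE /= ltn_eqF // (leq_trans lt_ic) // -ltnS ltn_ord.
pose sig T (y : multi_index n) i j l :=
  sigma (rho ^ 2) (matricize (@slice R d n T y i j l)).
have outer (u : core_space R n r tau) y i j l : uniq [:: i; j; l] ->
    ~~ correct_order tau (j, i, l) -> sig (phi r1 u) y i j l = 0.
  exact: sigma_slice_outer.
have middle i j l : uniq [:: i; j; l] -> correct_order tau (j, i, l) ->
    exists2 N : set (core_space R n r tau), lebesgue_null N &
      forall u, ~ N u -> forall y, 0 < sig (phi r1 u) y i j l.
  move=> ijl_uniq mid; have ni : (rho ^ 2 <= n i)%N.
    by case/orP: mid => /andP[]; apply: n_ge_mid.
  have [F [F_poly [v Fv_neq0] F_sig]] :=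
    sigma_slice_middle R r_gt0 r1 rho_gt0 r_ge n_ge ijl_uniq ni mid.
  pose N : set (core_space R n r tau) := fun u => F (coords u) = 0.
  exists N => [|u /eqP Fu_neq0]; last exact: F_sig.
  rewrite /lebesgue_null.
  have -> : [set coords u | u in N]%classic = [set v | F v = 0]%classic.
    apply/seteqP; split=> [_ [u Fu0 <-] //|w /= Fw0].
    by exists (uncoords w); rewrite /N uncoordsK.
  apply: polyfun_zeros_null F_poly Fv_neq0.
  exists ord0; split; first exact: Ordinal (n_gt0 ord0).
  by split; exact: Ordinal (r_gt0 _).
have rot_sig T y i j l : uniq [:: i; j; l] ->
    matricize (fun b c a => @slice R d n T y i j l a b c) =
    matricize (@slice R d n T y j l i).
  by move=> ijl_uniq; apply: eq_matricize => b c a; apply: slice_rot.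
have u2 : uniq [:: i2; i3; i1] by rewrite -(rot_uniq 1) in i_uniq.
have u3 : uniq [:: i3; i1; i2] by rewrite -(rot_uniq 1) in u2.
have three_indexE T y : three_index rho i1 i2 i3 T y =
    let a := sig T y i1 i2 i3 in let b := sig T y i2 i3 i1 in
    let c := sig T y i3 i1 i2 in
    if a > Num.max b c then Some (i2, i1, i3)
    else if b > Num.max a c then Some (i1, i2, i3)
    else if c > Num.max a b then Some (i2, i3, i1) else None.
  rewrite /three_index /sig (rot_sig T y i1 i2 i3 i_uniq).
  have -> : matricize (fun x3 x1 x2 => slice T y x1 x2 x3) =
            matricize (@slice R d n T y i3 i1 i2).
    apply: eq_matricize => c a b.
    by rewrite (slice_rot _ _ _ _ _ i_uniq) (slice_rot _ _ _ _ _ u2).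
  by [].
have order_rev i j l :
    correct_order tau (i, j, l) = correct_order tau (l, j, i).
  by rewrite /correct_order orbC.
have middle_unique i j l : correct_order tau (j, i, l) ->
    ~~ correct_order tau (l, j, i) /\ ~~ correct_order tau (i, l, j).
  by rewrite /correct_order; lia.
have [o1|no1] := boolP (correct_order tau (i2, i1, i3)).
  have [N N_null N_sig] := middle _ _ _ i_uniq o1.
  have [no2 no3] := middle_unique _ _ _ o1.
  exists N; split=> // u Nu y; exists (i2, i1, i3); split=> //.
  have a_gt0 := N_sig u Nu y.
  by rewrite three_indexE /= (outer _ _ i2) // (outer _ _ i3) // maxxx a_gt0.
have [o2|no2] := boolP (correct_order tau (i3, i2, i1)).
  have [N N_null N_sig] := middle _ _ _ u2 o2.
  have [no3 _] := middle_unique _ _ _ o2.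
  exists N; split=> // u Nu y; exists (i1, i2, i3).
  split; last by rewrite order_rev.
  have b_gt0 := N_sig u Nu y.
  rewrite three_indexE /= (outer _ _ i1) // (outer _ _ i3) //.
  by rewrite (max_l (ltW b_gt0)) ltNge (ltW b_gt0) /= maxxx b_gt0.
have o3 : correct_order tau (i1, i3, i2).
  have pos_neq i j : i != j -> (tau^-1)%g i != (tau^-1)%g j :> nat.
    by apply: contra_neq => /val_inj/perm_inj.
  move: i_uniq no1 no2; rewrite /correct_order /= !inE negb_or andbT.
  by case/andP=> /andP[/pos_neq + /pos_neq +] /pos_neq +; lia.
have [N N_null N_sig] := middle _ _ _ u3 o3.
exists N; split=> // u Nu y; exists (i2, i3, i1).
split; last by rewrite order_rev.
have c_gt0 := N_sig u Nu y.
rewrite three_indexE /= (outer _ _ i1) // (outer _ _ i2) //.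
by rewrite (max_r (ltW c_gt0)) ltNge (ltW c_gt0) /= maxxx c_gt0.
Qed.
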